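(* Let $G$ be a second-countable locally compact group, let $\pi:G\to\mathcal U(\mathcal H)$ be a strongly continuous unitary representation on an infinite-dimensional separable Hilbert space $\mathcal H$, and put $K=\operatorname{pker}(\pi)$. Assume that $\pi$ admits a local mixing-expansion datum $(A,p,U,(h_m))$. Then, for every $0<\varepsilon<1$, there exist a nonzero vector $\phi\in\mathcal H$ and a countable set $\Gamma\subset G$ such that $$(1-\varepsilon)^2\|f\|^2\leq \sum_{\gamma\in\Gamma}|\langle f,\pi(\gamma)\phi\rangle|^2\leq (1+\varepsilon)^2\|f\|^2\qquad(f\in\mathcal H).$$ Moreover, $\Gamma$ may be chosen so that the quotient map $q:G\to G/K$ is injective on $\Gamma$ and $q(\Gamma)$ is left relatively separated (hence closed and discrete).
   Context: $\mathcal U(\mathcal H)$ is the unitary group of the complex Hilbert space $\mathcal H$, and $\mathbb T=\{z\in\mathbb C:|z|=1\}$. The projective kernel of $\pi$ is the closed normal subgroup $\operatorname{pker}(\pi)=\{g\in G:\pi(g)\in\mathbb T I_{\mathcal H}\}$. Operators $T_m\to0$ in the weak operator topology (WOT) if $\langle u,T_mv\rangle\to0$ for all $u,v\in\mathcal H$. A local mixing-expansion datum for $\pi$ consists of a nondiscrete Hausdorff topological group $A$, a continuous homomorphism $p:A\to G$, an identity neighborhood $U\subset A$, and a sequence $(h_m)$ in $G$ such that $\pi(h_m)\to0$ in WOT and, for every $a\in U\setminus\{e_A\}$, $\pi(h_mp(a)h_m^{-1})\to0$ in WOT as $m\to\infty$. A subset $\Lambda$ of a locally compact group $Q$ is left relatively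 separated if for some relatively compact identity neighborhood $V\subset Q$ one has $\sup_{x\in Q}\#(\Lambda\cap xV)<\infty$. *)

(* Defs.v *)
From HB Require Import structures.
From mathcomp Require Import all_boot all_order all_algebra.
From mathcomp Require Import sesquilinear complex.
From mathcomp Require Import all_classical all_reals all_analysis.

Set Implicit Arguments.
Unset Strict Implicit.
Unset Printing Implicit Defensive.

Import Order.TTheory GRing.Theory Num.Theory.
Import numFieldNormedType.Exports.

Local Open Scope classical_set_scope.
Local Open Scope ring_scope.

(* Topological groups are not assumed to be Hausdorff; locally compact groups
   are, following the usual convention. *)
HB.mixin Record Topological_Group_isTopologicalGroup G
    of Topological G & Group G := {
  mulg_continuous : continuous (fun x : G * G => (x.1 * x.2)%g) ;
  invg_continuous : continuous (fun x : G => (x^-1)%g)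
}.

#[short(type="topologicalGroupType")]
HB.structure Definition TopologicalGroup :=
  {G of Topological G & Group G & Topological_Group_isTopologicalGroup G}.

Definition locally_compact_group (G : topologicalGroupType) : Prop :=
  hausdorff_space G /\ locally_compact [set: G].

Record normal_subgroup (G : groupType) := NormalSubgroup {
  normal_set :> set G ;
  normal1 : normal_set 1%g ;
  normalM : forall x y, normal_set x -> normal_set y -> normal_set (x * y)%g ;
  normalV : forall x, normal_set x -> normal_set (x^-1)%g ;
  normalJ : forall x y, normal_set x -> normal_set (x ^ y)%g
}.

Arguments normalJ {G n x} y.

Section Quotient.
Context (G : topologicalGroupType) (K : normal_subgroup G).
Local Open Scope quotient_scope.
Local Open Scope group_scope.

Definition coset_eq (x y : G) : bool := `[< normal_set K (x^-1 * y) >].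

Lemma coset_eq_refl : reflexive coset_eq.
Proof. by move=> x; apply/asboolP; rewrite mulVg; exact: normal1. Qed.

Lemma coset_eq_sym : symmetric coset_eq.
Proof.
move=> x y; apply/asboolP/asboolP => /normalV.
  by rewrite invgM invgK.
by rewrite invgM invgK.
Qed.

Lemma coset_eq_trans : transitive coset_eq.
Proof.
move=> y x z /asboolP xy /asboolP yz; apply/asboolP.
by have := normalM xy yz; rewrite mulgA mulgK.
Qed.

Canonical coset_equiv :=
  EquivRel coset_eq coset_eq_refl coset_eq_sym coset_eq_trans.

Definition quotient_group : Type := quotient_topology {eq_quot coset_eq}.

HB.instance Definition _ := Topological.on quotient_group.
HB.instance Definition _ := Quotient.on quotient_group.

Definition quotient_map (x : G) : quotient_group := \pi x.

Lemma quotient_mapP x y :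
  quotient_map x = quotient_map y <-> normal_set K (x^-1 * y).
Proof.
split => [/eqmodP/asboolP //|Kxy].
by apply/eqmodP/asboolP.
Qed.

Lemma quotient_map_surj (a : quotient_group) : exists x, a = quotient_map x.
Proof. by exists (repr a); rewrite /quotient_map reprK. Qed.

Definition quotient_mul (a b : quotient_group) : quotient_group :=
  quotient_map (repr a * repr b).
Definition quotient_inv (a : quotient_group) : quotient_group :=
  quotient_map (repr a)^-1.

Lemma repr_quotient_map x : normal_set K (x^-1 * repr (quotient_map x)).
Proof. by apply/quotient_mapP; rewrite /quotient_map reprK. Qed.

Lemma quotient_mapM x y :
  quotient_mul (quotient_map x) (quotient_map y) = quotient_map (x * y).
Proof.
apply/esym/quotient_mapP.
have Kx := normalJ y (repr_quotient_map x).
have := normalM Kx (repr_quotient_map y).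
by rewrite conjgE invgM !mulgA mulgK.
Qed.

Lemma quotient_mapV x : quotient_inv (quotient_map x) = quotient_map x^-1.
Proof.
apply/esym/quotient_mapP; rewrite invgK.
have := normalJ x^-1 (normalV (repr_quotient_map x)).
by rewrite conjgE !invgM !invgK !mulgA mulgK.
Qed.

Lemma quotient_mulA : associative quotient_mul.
Proof.
move=> a b c.
have [x ->] := quotient_map_surj a.
have [y ->] := quotient_map_surj b.
have [z ->] := quotient_map_surj c.
by rewrite !quotient_mapM mulgA.
Qed.

Lemma quotient_mul1 : left_id (quotient_map 1) quotient_mul.
Proof.
by move=> a; have [x ->] := quotient_map_surj a; rewrite quotient_mapM mul1g.
Qed.

Lemma quotient_mulr1 : right_id (quotient_map 1) quotient_mul.
Proof.
by move=> a; have [x ->] := quotient_map_surj a; rewrite quotient_mapM mulg1.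
Qed.

Lemma quotient_mulV :
  left_inverse (quotient_map 1) quotient_inv quotient_mul.
Proof.
move=> a; have [x ->] := quotient_map_surj a.
by rewrite quotient_mapV quotient_mapM mulVg.
Qed.

Lemma quotient_mulrV :
  right_inverse (quotient_map 1) quotient_inv quotient_mul.
Proof.
move=> a; have [x ->] := quotient_map_surj a.
by rewrite quotient_mapV quotient_mapM mulgV.
Qed.

HB.instance Definition _ := isGroup.Build quotient_group
  quotient_mulA quotient_mul1 quotient_mulr1 quotient_mulV quotient_mulrV.

Lemma quotient_map_morph : {morph quotient_map : x y / x * y}.
Proof. by move=> x y; rewrite -[LHS]quotient_mapM. Qed.

Lemma quotient_map_continuous : continuous quotient_map.
Proof. exact: pi_continuous. Qed.

Lemma mulgl_continuous (x : G) : continuous (fun y : G => x * y).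
Proof.
move=> y; apply: (@continuous_comp _ _ _ (fun y : G => (x, y))
  (fun z : G * G => z.1 * z.2)); last exact: mulg_continuous.
by apply: cvg_pair => /=; [exact: cvg_cst|exact: cvg_id].
Qed.

Lemma mulgr_continuous (x : G) : continuous (fun y : G => y * x).
Proof.
move=> y; apply: (@continuous_comp _ _ _ (fun y : G => (y, x))
  (fun z : G * G => z.1 * z.2)); last exact: mulg_continuous.
by apply: cvg_pair => /=; [exact: cvg_id|exact: cvg_cst].
Qed.

Lemma quotient_map_open (O : set G) : open O -> open (quotient_map @` O).
Proof.
move=> oO; suff : open (quotient_map @^-1` (quotient_map @` O)) by [].
rewrite (_ : _ @^-1` _ =
    \bigcup_(k in normal_set K) ((fun y => y * k) @^-1` O)).
  by apply: bigcup_open => k _; apply: open_comp => // y _;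
    exact: mulgr_continuous.
apply/seteqP; split => [y [x Ox /esym/quotient_mapP Kyx]|y [k Kk /= Ok]].
  by exists (y^-1 * x) => //=; rewrite mulVKg.
exists (y * k) => //; apply/esym/quotient_mapP.
by rewrite mulKg.
Qed.

Lemma quotient_mul_continuous :
  continuous (fun z : quotient_group * quotient_group => z.1 * z.2).
Proof.
move=> [a b] W /=.
have [x ->] := quotient_map_surj a; have [y ->] := quotient_map_surj b.
rewrite -quotient_map_morph => /quotient_map_continuous nW.
have [[A B] /= [nA nB] ABW] := mulg_continuous (x, y) _ nW.
exists (quotient_map @` A, quotient_map @` B) => /=.
  split.
    move: nA; rewrite !nbhsE => -[D [oD Dx] DA].
    exists (quotient_map @` D); last exact: image_subset.
    by split; [exact: quotient_map_open|exists x].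
  move: nB; rewrite !nbhsE => -[D [oD Dy] DB].
  exists (quotient_map @` D); last exact: image_subset.
  by split; [exact: quotient_map_open|exists y].
move=> [_ _] /= [[u Au <-] [v Bv <-]].
by rewrite -quotient_map_morph; exact: (ABW (u, v)).
Qed.

Lemma quotient_inv_continuous : continuous (fun a : quotient_group => a^-1).
Proof.
apply/continuousP => W oW.
suff : open (quotient_map @^-1` ((fun a : quotient_group => a^-1) @^-1` W)).
  by [].
rewrite (_ : _ @^-1` _ = (fun x : G => x^-1) @^-1` (quotient_map @^-1` W)).
  apply: open_comp => [x _|]; first exact: invg_continuous.
  by apply: open_comp => // x _; exact: quotient_map_continuous.
by apply/funext => x /=; rewrite -quotient_mapV.
Qed.

HB.instance Definition _ :=
  Topological_Group_isTopologicalGroup.Build quotient_group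
    quotient_mul_continuous quotient_inv_continuous.

End Quotient.

(* The supremum of the cardinals is finite iff they have a uniform finite
   bound N. *)
Definition left_relatively_separated (Q : topologicalGroupType)
    (L : set Q) : Prop :=
  exists V : set Q, [/\ nbhs (1%g : Q) V, precompact V &
    exists N : nat, forall x : Q,
      (L `&` [set (x * v)%g | v in V] #<= `I_N)%card].

Definition discrete_subset (T : topologicalType) (L : set T) : Prop :=
  L `<=` isolated L.

(* {dot H for conj} is a positive definite Hermitian form, linear in its first
   argument and conjugate-linear in the second. *)
HB.mixin Record CompleteNormedModule_isHilbert (R : realType) H
    of CompleteNormedModule R[i] H := {
  dotp : {dot H for (@Num.conj R[i])} ;
  dotp_norm : forall v : H, `|v| ^+ 2 = dotp v v
}.

#[short(type="hilbertType")]
HB.structure Definition Hilbert (R : realType) :=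
  {H of CompleteNormedModule R[i] H & CompleteNormedModule_isHilbert R H}.

Definition separable_space (T : topologicalType) : Prop :=
  exists2 D : set T, countable D & dense D.

Definition finite_dimensional (K : fieldType) (V : lmodType K) : Prop :=
  exists (n : nat) (e : 'I_n -> V), forall v : V,
    exists c : 'I_n -> K, v = \sum_i c i *: e i.

Definition unitary_operator (R : realType) (H : hilbertType R)
    (T : H -> H) : Prop :=
  [/\ linear T, bijective T & forall u v : H, dotp (T u) (T v) = dotp u v].

Record unitary_rep (G : groupType) (R : realType) (H : hilbertType R) :=
  UnitaryRep {
    rep_fun :> G -> H -> H ;
    rep_unitary : forall g, unitary_operator (rep_fun g) ;
    repM : forall g h, rep_fun (g * h)%g = rep_fun g \o rep_fun h
  }.

Definition strongly_continuous (G : topologicalGroupType) (R : realType)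
    (H : hilbertType R) (pi : unitary_rep G H) : Prop :=
  forall v : H, continuous (pi ^~ v).

Section ProjectiveKernel.
Context (G : groupType) (R : realType) (H : hilbertType R).
Variable pi : unitary_rep G H.

Definition pker_set : set G :=
  [set g | exists2 z : R[i], `|z| = 1 & forall v : H, pi g v = z *: v].

Lemma rep1 v : pi 1%g v = v.
Proof.
have [_ /bij_inj pi1I _] := rep_unitary pi 1%g.
by apply: pi1I; rewrite -[LHS]/((pi 1%g \o pi 1%g) v) -repM mulg1.
Qed.

Lemma repZ g (z : R[i]) v : pi g (z *: v) = z *: pi g v.
Proof.
have [lin _ _] := rep_unitary pi g.
have pi0 : pi g 0 = 0.
  have := lin 1 0 0; rewrite !scale1r addr0 => /eqP.
  by rewrite -subr_eq0 opprD addNKr oppr_eq0 => /eqP.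
by rewrite -[z *: v]addr0 lin pi0 addr0.
Qed.

Lemma repVK g v : pi g^-1%g (pi g v) = v.
Proof. by rewrite -[LHS]/((pi g^-1%g \o pi g) v) -repM mulVg rep1. Qed.

Lemma pker1 : pker_set 1%g.
Proof. by exists 1 => [|v]; rewrite ?normr1 // rep1 scale1r. Qed.

Lemma pkerM x y : pker_set x -> pker_set y -> pker_set (x * y)%g.
Proof.
move=> [a a1 ha] [b b1 hb]; exists (a * b) => [|v].
  by rewrite normrM a1 b1 mulr1.
by rewrite repM /= hb ha scalerA.
Qed.

Lemma pkerV x : pker_set x -> pker_set (x^-1)%g.
Proof.
move=> [a a1 ha]; have a0 : a != 0 by rewrite -normr_eq0 a1 oner_eq0.
exists a^-1 => [|v]; first by rewrite normfV a1 invr1.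
by rewrite -{1}[v](scalerKV a0) -ha repVK.
Qed.

Lemma pkerJ x y : pker_set x -> pker_set (x ^ y)%g.
Proof.
move=> [a a1 ha]; exists a => // v.
by rewrite conjgE !repM /= ha repZ repVK.
Qed.

Definition pker : normal_subgroup G := NormalSubgroup pker1 pkerM pkerV pkerJ.

End ProjectiveKernel.

(* R[i]^o is R[i] with the topology of its modulus. *)
Definition wot_cvg0 (R : realType) (H : hilbertType R)
    (T : nat -> H -> H) : Prop :=
  forall u v : H, (dotp u (T m v) : R[i]^o) @[m --> \oo] --> (0 : R[i]^o).

Record local_mixing_expansion_datum (G : topologicalGroupType) (R : realType)
    (H : hilbertType R) (pi : unitary_rep G H) := LocalMixingExpansionDatum {
  datum_group : topologicalGroupType ;
  datum_hausdorff : hausdorff_space datum_group ;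
  datum_nondiscrete : ~ forall a : datum_group, open [set a] ;
  datum_hom : datum_group -> G ;
  datum_homM : {morph datum_hom : a b / (a * b)%g} ;
  datum_hom_continuous : continuous datum_hom ;
  datum_nbhd : set datum_group ;
  datum_nbhdP : nbhs (1%g : datum_group) datum_nbhd ;
  datum_seq : nat -> G ;
  datum_mixing : wot_cvg0 (fun m => pi (datum_seq m)) ;
  datum_expansion : forall a, datum_nbhd a -> a <> 1%g ->
    wot_cvg0 (fun m =>
      pi (datum_seq m * datum_hom a * (datum_seq m)^-1)%g)
}.

(* Norms on modules over R[i], including the modulus on R[i] itself, take
   values in R[i]; rnorm is the corresponding real number. *)
Definition rnorm (R : realType) (V : normedZmodType R[i]) (v : V) : R :=
  complex.Re `|v|.

(* Main.v *)
Require Import Defs.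
From HB Require Import structures.
From mathcomp Require Import all_boot all_order all_algebra.
From mathcomp Require Import sesquilinear complex.
From mathcomp Require Import all_classical all_reals all_analysis.
From mathcomp Require Import ring lra.

(* Let (e_n) be a Parseval sequence of H, c_n = 1/M_n with M_n integers growing
   very fast, and phi = sum_n c_n pi(h_(m_n)) e_n. Stage n uses N_n = M_n^2
   elements g_(n,i) = p(a_(n,i)) h_(m_n)^-1, where the points a_(n,i) are distinct
   and so close to the identity that pi(p(a_(n,i))) almost fixes e_n. Then
   pi(g_(n,i)) phi is c_n e_n plus noise, and since N_n c_n^2 = 1 the main terms
   sum to |f|^2. The noise has three parts: the error in pi(p(a_(n,i))) e_n = e_n
   and the later terms of phi are small in norm even after summing over the block,
   while the images of the earlier terms of phi are almost orthogonal to one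
   another, because m_n is chosen after everything at the earlier stages: pairs
   from different stages are decorrelated by the mixing of (h_m), pairs in the same
   stage by the expansion property applied to a_(n,i)^-1 a_(n,j).
   The same choice makes |<psi, pi(g^-1 g') psi>| <= 1/2 for distinct g, g' and a
   fixed unit vector psi; this coefficient has modulus 1 on K and exceeds 1/2 near
   the identity, which gives injectivity and separation modulo K. *)

Set Implicit Arguments.
Unset Strict Implicit.
Unset Printing Implicit Defensive.

Import Order.TTheory GRing.Theory Num.Theory.
Import numFieldNormedType.Exports.

Local Open Scope classical_set_scope.
Local Open Scope ring_scope.
Local Open Scope complex_scope.

(** * Real-valued norms and the Cauchy-Schwarz inequality *)

Section RealNorm.
Context (R : realType) (V : normedZmodType R[i]).
Implicit Types u v : V.

Lemma rnormE v : `|v| = (rnorm v)%:C.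
Proof. by rewrite /rnorm RRe_real// ger0_real. Qed.

Lemma rnorm_ge0 v : 0 <= rnorm v.
Proof. by rewrite -ler0c -rnormE. Qed.

Lemma rnormD u v : rnorm (u + v) <= rnorm u + rnorm v.
Proof. by rewrite -lecR rmorphD/= -!rnormE ler_normD. Qed.

Lemma rnormN v : rnorm (- v) = rnorm v.
Proof. by rewrite /rnorm normrN. Qed.

Lemma rnorm0 : rnorm (0 : V) = 0.
Proof. by rewrite /rnorm normr0. Qed.

Lemma rnorm_eq0 v : (rnorm v == 0) = (v == 0).
Proof. by rewrite -[RHS]normr_eq0 rnormE -(inj_eq (@complexI R)). Qed.

Lemma rnorm_distC u v : rnorm (u - v) = rnorm (v - u).
Proof. by rewrite /rnorm distrC. Qed.

Lemma rnorm_sum (I : Type) (r : seq I) (P : pred I) (F : I -> V) :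
  rnorm (\sum_(i <- r | P i) F i) <= \sum_(i <- r | P i) rnorm (F i).
Proof.
elim/big_rec2 : _ => [|i y x _ le_xy]; first by rewrite rnorm0.
by rewrite (le_trans (rnormD _ _))// lerD2l.
Qed.

End RealNorm.

Lemma rnormM (R : realType) (z w : R[i]) : rnorm (z * w) = rnorm z * rnorm w.
Proof. by apply: (@complexI R); rewrite rmorphM/= -!rnormE normrM. Qed.

Lemma rnorm_real (R : realType) (x : R) : rnorm (x%:C : R[i]) = `|x|.
Proof.
by rewrite /rnorm normc_def/= expr0n addr0 sqrtr_sqr.
Qed.

Lemma rnorm_conj (R : realType) (z : R[i]) : rnorm (z^*)%R = rnorm z.
Proof. by rewrite /rnorm norm_conjC. Qed.

Lemma sqr_rnorm (R : realType) (z : R[i]) : (rnorm z ^+ 2)%:C = z * (z^*)%R.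
Proof. by rewrite rmorphXn/= -rnormE normCK. Qed.

Lemma conj_real_complex (R : realType) (x : R) : ((x%:C)^*)%R = x%:C.
Proof. by apply: conj_Creal; rewrite complex_real. Qed.

Section InnerProduct.
Context (R : realType) (H : hilbertType R).
Implicit Types (u v w : H) (z : R[i]).

Lemma rnormZ z v : rnorm (z *: v) = rnorm z * rnorm v.
Proof. by apply: (@complexI R); rewrite rmorphM/= -!rnormE normrZ. Qed.

Lemma dotpp v : dotp v v = (rnorm v ^+ 2)%:C.
Proof. by rewrite -dotp_norm rmorphXn/= -rnormE. Qed.

Lemma dotpC u v : dotp u v = ((dotp v u)^*)%R.
Proof. by rewrite hermC expr0 mul1r. Qed.

Lemma rnorm_dotpC u v : rnorm (dotp u v) = rnorm (dotp v u).
Proof. by rewrite dotpC rnorm_conj. Qed.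

Lemma dotpZl z u v : dotp (z *: u) v = z * dotp u v.
Proof. exact: linearZl_LR. Qed.

Lemma dotpZr z u v : dotp u (z *: v) = (z^*)%R * dotp u v.
Proof. by rewrite dotpC dotpZl rmorphM/= -dotpC. Qed.

Lemma dotpDr u v w : dotp w (u + v) = dotp w u + dotp w v.
Proof. exact: linearDr. Qed.

Lemma dotpBl u v w : dotp (u - v) w = dotp u w - dotp v w.
Proof. exact: linearBl. Qed.

Lemma dotpBr u v w : dotp w (u - v) = dotp w u - dotp w v.
Proof. exact: linearBr. Qed.

Lemma dotp_suml (I : Type) (r : seq I) (P : pred I) (F : I -> H) v :
  dotp (\sum_(i <- r | P i) F i) v = \sum_(i <- r | P i) dotp (F i) v.
Proof. exact: linear_sumlz. Qed.

Lemma dotp_sumr (I : Type) (r : seq I) (P : pred I) (F : I -> H) v :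
  dotp v (\sum_(i <- r | P i) F i) = \sum_(i <- r | P i) dotp v (F i).
Proof. exact: linear_sumr. Qed.

Lemma rnorm_dotpp v : rnorm (dotp v v) = rnorm v ^+ 2.
Proof. by rewrite dotpp rnorm_real ger0_norm// sqr_ge0. Qed.

Lemma cauchy_schwarz u v : rnorm (dotp u v) <= rnorm u * rnorm v.
Proof.
have [->|v0] := eqVneq v 0.
  by rewrite linear0r !rnorm0 mulr0.
have nv0 : 0 < rnorm v by rewrite lt_neqAle eq_sym rnorm_eq0 v0 rnorm_ge0.
rewrite -(@ler_pXn2r _ 2)// ?nnegrE ?mulr_ge0 ?rnorm_ge0//.
pose d := dotp u v; pose n2 := rnorm v ^+ 2.
have := sqr_ge0 (rnorm (n2%:C *: u - d *: v)); rewrite -ler0c -dotpp.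
rewrite dotpBl !dotpBr !dotpZl !dotpZr (dotpC v u) !dotpp -/d -/n2 conj_real_complex.
have -> : n2%:C * (n2%:C * (rnorm u ^+ 2)%:C) - n2%:C * (d^*%R * d) -
    (d * (n2%:C * d^*%R) - d * (d^*%R * n2%:C)) =
    n2%:C * (n2%:C * (rnorm u ^+ 2)%:C - d * d^*%R) by ring.
rewrite -sqr_rnorm -!rmorphM/= -rmorphB/= -rmorphM/= ler0c pmulr_rge0 ?exprn_gt0//.
by rewrite subr_ge0 mulrC exprMn.
Qed.

End InnerProduct.

(** * Bessel-type inequalities for almost orthogonal and perturbed systems *)

Section BesselBounds.
Context (R : realType) (H : hilbertType R).

(** Duality: the left side [S] equals [dotp f x] for [x] the sum of the [t i *: v i], so [S] is at
    most [rnorm f * rnorm x]. Expanding [rnorm x ^+ 2] through the Gram matrix gives at most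
    [(D + W) * S], because the product form [w i * w j] lets the arithmetic-geometric mean
    inequality decouple the off-diagonal double sum. *)
Lemma gram_bessel (I : finType) (v : I -> H) (w : I -> R) (D W : R) (f : H) :
  0 <= D -> (forall i, rnorm (v i) ^+ 2 <= D) ->
  (forall i j, i != j -> rnorm (dotp (v i) (v j)) <= w i * w j) ->
  \sum_i w i ^+ 2 <= W ->
  \sum_i rnorm (dotp f (v i)) ^+ 2 <= (D + W) * rnorm f ^+ 2.
Proof.
move=> D0 vD vw wW.
set S := (X in X <= _).
pose t i := dotp f (v i); pose x := \sum_i t i *: v i.
have S0 : 0 <= S by apply: sumr_ge0 => i _; exact: sqr_ge0.
have Sfx : S%:C = dotp f x.
  rewrite dotp_sumr rmorph_sum/=; apply: eq_bigr => i _.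
  by rewrite dotpZr sqr_rnorm mulrC.
have SC : S <= rnorm f * rnorm x.
  by rewrite -(ger0_norm S0) -rnorm_real Sfx cauchy_schwarz.
have xle : rnorm x ^+ 2 <= \sum_i \sum_j
    rnorm (t i) * rnorm (t j) * rnorm (dotp (v i) (v j)).
  rewrite -rnorm_dotpp dotp_suml (le_trans (rnorm_sum _ _ _))// ler_sum// => i _.
  rewrite dotpZl dotp_sumr mulr_sumr (le_trans (rnorm_sum _ _ _))// ler_sum// => j _.
  by rewrite dotpZr !rnormM rnorm_conj mulrA.
have offdiag i j : rnorm (t i) * rnorm (t j) * rnorm (dotp (v i) (v j)) <=
    (if j == i then rnorm (t i) ^+ 2 * D else 0) +
    (rnorm (t i) ^+ 2 * w j ^+ 2 + rnorm (t j) ^+ 2 * w i ^+ 2) / 2.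
  have [->|ji] := eqVneq j i.
    rewrite rnorm_dotpp -expr2 -[leLHS]addr0 lerD//.
      by rewrite ler_wpM2l// sqr_ge0.
    by rewrite divr_ge0// addr_ge0// mulr_ge0// sqr_ge0.
  rewrite add0r; apply: (@le_trans _ _ (rnorm (t i) * rnorm (t j) * (w i * w j))).
    by rewrite ler_wpM2l ?mulr_ge0 ?rnorm_ge0// vw// eq_sym.
  have := sqr_ge0 (rnorm (t i) * w j - rnorm (t j) * w i).
  by nra.
have {}xle : rnorm x ^+ 2 <= (D + W) * S.
  apply: (le_trans xle); apply: (@le_trans _ _ (\sum_i \sum_j
      ((if j == i then rnorm (t i) ^+ 2 * D else 0) +
      (rnorm (t i) ^+ 2 * w j ^+ 2 + rnorm (t j) ^+ 2 * w i ^+ 2) / 2))).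
    by apply: ler_sum => i _; apply: ler_sum => j _; exact: offdiag.
  have Sw : \sum_i \sum_j rnorm (t i) ^+ 2 * w j ^+ 2 <= W * S.
    under eq_bigr do rewrite -mulr_sumr.
    by rewrite -mulr_suml mulrC ler_wpM2r.
  rewrite (eq_bigr (fun i => rnorm (t i) ^+ 2 * D +
    ((\sum_j rnorm (t i) ^+ 2 * w j ^+ 2) +
    (\sum_j rnorm (t j) ^+ 2 * w i ^+ 2)) / 2)); last first.
    by move=> i _; rewrite big_split/= -big_mkcond/= big_pred1_eq -mulr_suml big_split.
  rewrite big_split/= -!mulr_suml big_split/=.
  rewrite [X in _ + (_ + X) / _]exchange_big/= -[\sum_i rnorm _ ^+ 2]/S.
  by lra.
have W0 : 0 <= W by apply: le_trans wW; apply: sumr_ge0 => i _; exact: sqr_ge0.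
have [->|Sn0] := eqVneq S 0; first by rewrite mulr_ge0 ?sqr_ge0 ?addr_ge0.
have Sgt0 : 0 < S by rewrite lt_neqAle eq_sym Sn0.
rewrite -(ler_pM2r Sgt0).
apply: (@le_trans _ _ ((rnorm f * rnorm x) ^+ 2)).
  by rewrite -expr2 ler_pXn2r// nnegrE mulr_ge0 ?rnorm_ge0.
by rewrite exprMn [leLHS]mulrC [leRHS]mulrAC ler_wpM2r// sqr_ge0.
Qed.

(** Termwise Young inequality with weights [e] and [e^-1], balanced for noise of size [e ^+ 2 * F].
    The lower bound keeps [X] because the main terms will be a finite Parseval sum; as [X] tends to
    [F] it becomes [(1 - e) ^+ 2 * F]. *)
Lemma bessel_perturb (I : finType) (x y : I -> R[i]) (e F X : R) :
  0 < e -> e < 1 ->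
  \sum_i rnorm (x i) ^+ 2 = X -> X <= F ->
  \sum_i rnorm (y i) ^+ 2 <= e ^+ 2 * F ->
  (1 - e) * X - e * (1 - e) * F <= \sum_i rnorm (x i + y i) ^+ 2
    <= (1 + e) ^+ 2 * F.
Proof.
move=> e0 e1 xX XF yF.
have eV : e * e^-1 = 1 by rewrite divff// gt_eqF.
have eV1 : 1 < e^-1 by rewrite invf_gt1.
have xy i : (1 - e) * rnorm (x i) ^+ 2 + (1 - e^-1) * rnorm (y i) ^+ 2
    <= rnorm (x i + y i) ^+ 2
    <= (1 + e) * rnorm (x i) ^+ 2 + (1 + e^-1) * rnorm (y i) ^+ 2.
  have le1 := rnormD (x i) (y i).
  have le2 : rnorm (x i) - rnorm (y i) <= rnorm (x i + y i).
    by have := rnormD (x i + y i) (- y i); rewrite addrK rnormN -lerBlDr.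
  have le3 : rnorm (y i) - rnorm (x i) <= rnorm (x i + y i).
    by have := rnormD (x i + y i) (- x i); rewrite addrC addKr rnormN -lerBlDr.
  have x0 := rnorm_ge0 (x i); have y0 := rnorm_ge0 (y i).
  have z0 := rnorm_ge0 (x i + y i).
  set a := rnorm (x i) in le1 le2 le3 x0 *; set b := rnorm (y i) in le1 le2 le3 y0 *.
  set c := rnorm (x i + y i) in le1 le2 le3 z0 *.
  have amgm : 2 * a * b <= e * a ^+ 2 + e^-1 * b ^+ 2.
    have -> : e * a ^+ 2 + e^-1 * b ^+ 2 = 2 * a * b + e^-1 * (e * a - b) ^+ 2.
      by field; rewrite gt_eqF.
    by rewrite lerDl mulr_ge0 ?sqr_ge0// invr_ge0 ltW.
  apply/andP; split.
    apply: (@le_trans _ _ ((a - b) ^+ 2)); first by nra.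
    have [ab|ba] := leP b a; first by rewrite ler_pXn2r// nnegrE subr_ge0.
    by rewrite -sqrrN opprB ler_pXn2r// nnegrE subr_ge0 ltW.
  apply: (@le_trans _ _ ((a + b) ^+ 2)); last by nra.
  by rewrite ler_pXn2r// nnegrE addr_ge0.
apply/andP; split.
  apply: (@le_trans _ _ (\sum_i
    ((1 - e) * rnorm (x i) ^+ 2 + (1 - e^-1) * rnorm (y i) ^+ 2))).
    rewrite big_split/= -!mulr_sumr xX lerD2l.
    have -> : - (e * (1 - e) * F) = (1 - e^-1) * (e ^+ 2 * F).
      by field; rewrite gt_eqF.
    by rewrite ler_wnM2l// subr_le0 ltW.
  by apply: ler_sum => i _; case/andP: (xy i).
apply: (@le_trans _ _ (\sum_i
    ((1 + e) * rnorm (x i) ^+ 2 + (1 + e^-1) * rnorm (y i) ^+ 2))).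
  by apply: ler_sum => i _; case/andP: (xy i).
rewrite big_split/= -!mulr_sumr xX.
have -> : (1 + e) ^+ 2 * F = (1 + e) * F + (1 + e^-1) * (e ^+ 2 * F).
  by field; rewrite gt_eqF.
by rewrite lerD// ler_wpM2l// addr_ge0// ?ltW// (lt_trans ltr01).
Qed.

Lemma sqr_sum3_le (a b c : R) : (a + b + c) ^+ 2 <= 3 * (a ^+ 2 + b ^+ 2 + c ^+ 2).
Proof.
by have := sqr_ge0 (a - b); have := sqr_ge0 (b - c); have := sqr_ge0 (a - c); nra.
Qed.

End BesselBounds.

(** * Gram-Schmidt and Parseval sequences in a separable space *)

Section GramSchmidt.
Context (R : realType) (H : hilbertType R).

(** Since the inverse of 0 is 0, the zero vector is sent to itself; Gram-Schmidt thus runs on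
    dependent families. *)
Definition normalize (v : H) : H := ((rnorm v)^-1)%:C *: v.

Lemma rnorm_normalize v : v != 0 -> rnorm (normalize v) = 1.
Proof.
move=> v0; rewrite rnormZ rnorm_real ger0_norm ?invr_ge0 ?rnorm_ge0//.
by rewrite mulVf// rnorm_eq0.
Qed.

Lemma rnorm_normalize_le1 v : rnorm (normalize v) <= 1.
Proof.
have [->|v0] := eqVneq v 0; last by rewrite rnorm_normalize.
by rewrite /normalize scaler0 rnorm0 ler01.
Qed.

Lemma normalizeE v : v = (rnorm v)%:C *: normalize v.
Proof.
have [->|v0] := eqVneq v 0; first by rewrite /normalize !scaler0.
by rewrite scalerA -rmorphM/= mulfV ?rnorm_eq0// scale1r.
Qed.

Lemma rnorm_sub_proj (u v : H) : dotp u v * dotp v v = dotp u v ->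
  rnorm (u - dotp u v *: v) ^+ 2 = rnorm u ^+ 2 - rnorm (dotp u v) ^+ 2.
Proof.
move=> uv; apply: (@complexI R); rewrite rmorphB/= -!dotpp sqr_rnorm.
rewrite !(dotpBl, dotpBr, dotpZl, dotpZr) [dotp v u]dotpC mulrCA uv.
by rewrite [(_^*)%R * dotp u v]mulrC subrr subr0.
Qed.

Variable d : nat -> H.

(* The component orthogonal to [d 0, ..., d n.-1]. *)
Fixpoint gs_residual (n : nat) : H -> H :=
  if n is n'.+1 then
    fun f => gs_residual n' f - dotp (gs_residual n' f)
      (normalize (gs_residual n' (d n'))) *: normalize (gs_residual n' (d n'))
  else id.

(* This is [0] when [d n] is a combination of the earlier vectors. *)
Definition gram_schmidt (n : nat) : H := normalize (gs_residual n (d n)).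

Local Notation e := gram_schmidt.
Local Notation res := gs_residual.

Lemma gs_residualS n f : res n.+1 f = res n f - dotp (res n f) (e n) *: e n.
Proof. by []. Qed.

Lemma gs_residualB n f g : res n (f - g) = res n f - res n g.
Proof.
elim: n => // n IH.
by rewrite !gs_residualS IH dotpBl scalerBl !opprD !opprK addrACA.
Qed.

Lemma gs_residual_orth n k f : (k < n)%N -> dotp (res n f) (e k) = 0.
Proof.
elim: n f => // n IH f; rewrite ltnS leq_eqVlt => /predU1P[->|kn].
  have [dn0|dn0] := eqVneq (res n (d n)) 0.
    by rewrite /e dn0 /normalize scaler0 linear0r.
  by rewrite gs_residualS dotpBl dotpZl (dotpp (e n)) rnorm_normalize//
    expr1n mulr1 subrr.
by rewrite gs_residualS dotpBl dotpZl IH// {3}/e dotpZl IH// !mulr0 subr0.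
Qed.

Lemma gram_schmidt_orth k n : (k < n)%N -> dotp (e n) (e k) = 0.
Proof. by move=> kn; rewrite {1}/e dotpZl gs_residual_orth ?mulr0. Qed.

(** The residual differs from [f] by a combination of earlier vectors, all orthogonal to [e n]. *)
Lemma dotp_gs_residual n f : dotp (res n f) (e n) = dotp f (e n).
Proof.
suff H0 m : (m <= n)%N -> dotp (res m f) (e n) = dotp f (e n) by exact: H0.
elim: m => // m IH mn.
by rewrite gs_residualS dotpBl dotpZl [dotp (e m) _]dotpC gram_schmidt_orth//
  conjC0 mulr0 subr0 IH// ltnW.
Qed.

Lemma rnorm_gs_residual n f :
  rnorm (res n f) ^+ 2 = rnorm f ^+ 2 - \sum_(k < n) rnorm (dotp f (e k)) ^+ 2.
Proof.
elim: n => [|n IH]; first by rewrite big_ord0 subr0.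
rewrite big_ord_recr/= opprD addrA -IH -(dotp_gs_residual n f) -/(e n).
rewrite rnorm_sub_proj//.
have [dn0|dn0] := eqVneq (res n (d n)) 0.
  by rewrite /e dn0 /normalize scaler0 linear0r !mul0r.
by rewrite [dotp (e n) _]dotpp rnorm_normalize// expr1n mulr1.
Qed.

Lemma gs_residual_in n : res n.+1 (d n) = 0.
Proof.
have [dn0|dn0] := eqVneq (res n (d n)) 0.
  by rewrite gs_residualS dn0 linear0l scale0r subrr.
rewrite gs_residualS -/(e n) {1 2}[res n (d n)]normalizeE dotpZl -/(e n).
by rewrite dotpp rnorm_normalize// expr1n mulr1 subrr.
Qed.

Lemma gram_schmidt_bessel n f :
  \sum_(k < n) rnorm (dotp f (e k)) ^+ 2 <= rnorm f ^+ 2.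
Proof. by rewrite -subr_ge0 -rnorm_gs_residual sqr_ge0. Qed.

(** The residual of order [n.+1] kills [d n], so [f] and [f - d n] have the same one, and its norm
    is at most that of [f - d n]. *)
Lemma gram_schmidt_parseval n f :
  rnorm f ^+ 2 - rnorm (f - d n) ^+ 2 <=
    \sum_(k < n.+1) rnorm (dotp f (e k)) ^+ 2.
Proof.
rewrite lerBlDl -lerBlDr -rnorm_gs_residual.
have -> : res n.+1 f = res n.+1 (f - d n).
  by rewrite gs_residualB gs_residual_in subr0.
rewrite rnorm_gs_residual lerBlDr lerDl.
by apply: sumr_ge0 => i _; exact: sqr_ge0.
Qed.

End GramSchmidt.

Lemma near_rnorm (R : realType) (H : hilbertType R) (v : H) (e : R) :
  0 < e -> \forall u \near v, rnorm (v - u) < e.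
Proof.
move=> e0; have : \forall u \near v, `|v - u| < e%:C.
  by apply: (@cvgr_dist_lt _ _ _ (nbhs v) _ id v) => //; rewrite ltcR.
by apply: filterS => u; rewrite rnormE ltcR.
Qed.

Lemma dense_sequence (T : topologicalType) (x0 : T) (D : set T) :
  countable D -> dense D ->
  exists d : nat -> T, forall O, open O -> O !=set0 -> exists n, O (d n).
Proof.
move=> /countable_injP[f finj] dD.
exists (fun n => xget x0 [set x | D x /\ f x = n]) => O oO O0.
have [x [Ox Dx]] := dD O O0 oO.
exists (f x); case: xgetP => [y _ [Dy fyx]|/(_ x)]; last by case.
by rewrite (finj y x)// ?inE.
Qed.

(** Substitute for an orthonormal basis: some [e n] may vanish, and Parseval's identity is expressed
    by finite sums approaching [rnorm f ^+ 2] from below. *)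
Lemma parseval_sequence (R : realType) (H : hilbertType R) :
  separable_space H -> exists e : nat -> H,
  [/\ forall n, rnorm (e n) <= 1,
     forall n f, \sum_(k < n) rnorm (dotp f (e k)) ^+ 2 <= rnorm f ^+ 2 &
     forall f x, x < rnorm f ^+ 2 ->
       exists n, x < \sum_(k < n) rnorm (dotp f (e k)) ^+ 2].
Proof.
move=> [D cD dD]; have [d dd] := dense_sequence 0 cD dD.
exists (gram_schmidt d); split => [n|n f|f x xf].
- exact: rnorm_normalize_le1.
- exact: gram_schmidt_bessel.
pose r := Num.sqrt (rnorm f ^+ 2 - x).
have r0 : 0 < r by rewrite sqrtr_gt0 subr_gt0.
have : nbhs f [set u | rnorm (f - u) < r] := near_rnorm f r0.
rewrite nbhsE => -[B [oB Bf] Br].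
have [|n Bdn] := dd B oB; first by exists f.
exists n.+1; have /= fd := Br _ Bdn.
apply: lt_le_trans (gram_schmidt_parseval d n f).
rewrite ltrBrDl -ltrBrDr.
rewrite -(sqr_sqrtr (_ : 0 <= rnorm f ^+ 2 - x)) ?subr_ge0 1?ltW//.
by rewrite ltr_pXn2r// ?nnegrE ?rnorm_ge0 ?ltW.
Qed.

(** * Unitary representations; tools on limits, choice and nondiscrete groups *)

Section UnitaryRep.
Context (G : groupType) (R : realType) (H : hilbertType R).
Variable pi : unitary_rep G H.

Lemma repD g u v : pi g (u + v) = pi g u + pi g v.
Proof. by have [lin _ _] := rep_unitary pi g; have := lin 1 u v; rewrite !scale1r. Qed.

Lemma repMv g h v : pi (g * h)%g v = pi g (pi h v).
Proof. by rewrite repM. Qed.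

Lemma dotp_rep g u v : dotp (pi g u) (pi g v) = dotp u v.
Proof. by have [_ _ ->] := rep_unitary pi g. Qed.

Lemma rnorm_rep g v : rnorm (pi g v) = rnorm v.
Proof. by apply/eqP; rewrite -(@eqrXn2 _ 2)// ?rnorm_ge0// -!rnorm_dotpp dotp_rep. Qed.

Lemma dotp_rep_rep g h u v : dotp (pi g u) (pi h v) = dotp u (pi (g^-1 * h)%g v).
Proof. by rewrite -(dotp_rep g u) -repMv mulVKg. Qed.

End UnitaryRep.

Lemma hilbert_cauchy (R : realType) (H : hilbertType R) (u : nat -> H)
    (t : nat -> R) :
  (forall n m, (n <= m)%N -> rnorm (u m - u n) <= t n) ->
  (forall e, 0 < e -> exists n, t n < e) ->
  exists l, forall n, rnorm (l - u n) <= t n.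
Proof.
move=> ut t0.
have : cvg (u @ \oo).
  apply/cauchy_cvgP/cauchyP => e e0.
  have eE : e = (complex.Re e)%:C by rewrite RRe_real// gtr0_real.
  have [|n tn] := t0 (complex.Re e); first by rewrite -ltcR -eE.
  exists (u n); exists n => // m /= nm.
  rewrite -ball_normE/= rnormE eE ltcR rnorm_distC.
  exact: le_lt_trans (ut _ _ nm) tn.
move=> /cvg_ex[l ul]; exists l => n; apply/ler_addgt0Pr => e e0.
have e0' : 0 < e%:C by rewrite ltcR.
have /cvgr_dist_lt/(_ _ e0')[N _ lN] := ul.
have /= := lN (maxn N n) (leq_maxl _ _); rewrite rnormE ltcR => lt_e.
rewrite -(subrKA (u (maxn N n))) (le_trans (rnormD _ _))// addrC.
by rewrite lerD ?ut ?leq_maxr// ltW.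
Qed.

(** The first hypothesis says that [P m n] sees only the values of [m] below [n]. The sequence is
    built from the list of values chosen so far; the default 0 of [nth] is then never consulted. *)
Lemma course_of_values_choice (P : (nat -> nat) -> nat -> nat -> Prop) :
  (forall m m' n x, (forall k, (k < n)%N -> m k = m' k) ->
    P m n x -> P m' n x) ->
  (forall m n, exists x, P m n x) ->
  exists m, forall n, P m n (m n).
Proof.
move=> Pext exP.
have /choice[f fP] m : exists f, forall n, P m n (f n).
  by have /choice[f fP] := exP m; exists f.
pose s := fix s n := if n is n'.+1 then rcons (s n') (f (nth 0%N (s n')) n') else [::].
have size_s n : size (s n) = n by elim: n => //= n IH; rewrite size_rcons IH.
pose m n := f (nth 0%N (s n)) n.
have sE n k : (k < n)%N -> nth 0%N (s n) k = m k.
  elim: n => // n IH; rewrite ltnS /= nth_rcons size_s leq_eqVlt.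
  by move=> /predU1P[->|kn]; rewrite ?ltnn ?eqxx// kn IH.
by exists m => n; apply: Pext (fP (nth 0%N (s n)) n) => k; exact: sE.
Qed.

(** If [W] were finite, removing the closed finite set [W] minus the identity would leave the
    identity isolated, and translation would make the whole group discrete. *)
Lemma nbhs_infinite (A : topologicalGroupType) (W : set A) :
  hausdorff_space A -> (~ forall a : A, open [set a]) ->
  nbhs (1%g : A) W -> infinite_set W.
Proof.
move=> hA nd W1 finW; apply: nd => a.
have closedA : forall F : set A, finite_set F -> closed F.
  by apply/accessible_finite_set_closed; exact: hausdorff_accessible.
have n1 : nbhs (1%g : A) [set 1%g].
  have cWD : closed (W `\ 1%g) by apply: closedA; exact: finite_setD.
  have : nbhs (1%g : A) (~` (W `\ 1%g)).
    by apply: open_nbhs_nbhs; split; [exact: closed_openC|move=> -[_]; exact].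
  move=> /(filterI W1); apply: filterS => x [Wx /not_andP[//|/contrapT]].
  exact.
rewrite openE => _ /= ->; rewrite /interior.
have : nbhs a ((fun x : A => (a^-1 * x)%g) @^-1` [set 1%g]).
  by apply: mulgl_continuous; rewrite mulVg.
by apply: filterS => x /= x1; apply: (mulgI a^-1%g); rewrite mulVg.
Qed.

Lemma wot_cvg0_near (R : realType) (H : hilbertType R) (T : nat -> H -> H)
    (u v : H) (e : R) :
  wot_cvg0 T -> 0 < e -> \forall m \near \oo, rnorm (dotp u (T m v)) <= e.
Proof.
move=> T0 e0; have e0' : 0 < e%:C by rewrite ltcR.
have /cvgr0_norm_le/(_ _ e0') := T0 u v.
by apply: filterS => m; rewrite rnormE lecR.
Qed.

(** * Topology of the quotient by the projective kernel, and separation there *)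

Section QuotientTopology.
Context (G : topologicalGroupType) (K : normal_subgroup G).
Local Notation q := (@quotient_map G K).

Lemma divg_continuous : continuous (fun z : G * G => (z.1^-1 * z.2)%g).
Proof.
move=> z; apply: (@continuous_comp _ _ _ (fun z : G * G => (z.1^-1, z.2)%g)
  (fun z : G * G => z.1 * z.2)%g); last exact: mulg_continuous.
apply: cvg_pair => /=; last exact: cvg_snd.
apply: (@continuous_comp _ _ _ fst (fun x : G => x^-1%g)).
  exact: cvg_fst.
exact: invg_continuous.
Qed.

Lemma nbhs_divg (x y : G) (W : set G) : nbhs (x^-1 * y)%g W ->
  exists A B : set G, [/\ nbhs x A, nbhs y B &
    forall a b, A a -> B b -> W (a^-1 * b)%g].
Proof.
move=> /(divg_continuous (x := (x, y)))[[A B] /= [nA nB] AB].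
by exists A, B; split => // a b Aa Bb; exact: (AB (a, b)).
Qed.

Lemma nbhs_quotient_map (x : G) (A : set G) : nbhs x A -> nbhs (q x) (q @` A).
Proof.
rewrite !nbhsE => -[D [oD Dx] DA].
exists (q @` D); last exact: image_subset.
by split; [exact: quotient_map_open|exists x].
Qed.

Lemma quotient_hausdorff : closed (normal_set K) ->
  hausdorff_space (quotient_group K).
Proof.
move=> cK a b; have [x ->] := quotient_map_surj a.
have [y ->] := quotient_map_surj b => qxy.
apply: contrapT => /quotient_mapP Kxy.
have [|A [B [nA nB AB]]] := @nbhs_divg x y (~` normal_set K).
  by apply: open_nbhs_nbhs; split => //; exact: closed_openC.
have [_ [[u Au <-] [v Bv /esym/quotient_mapP]]] :=
  qxy _ _ (nbhs_quotient_map nA) (nbhs_quotient_map nB).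
exact: AB.
Qed.

End QuotientTopology.

Section ProjectiveKernelTopology.
Context (G : topologicalGroupType) (R : realType) (H : hilbertType R).
Variable pi : unitary_rep G H.
Context (pi_cont : strongly_continuous pi).

Lemma near_rep (g : G) (v : H) (e : R) : 0 < e ->
  \forall x \near g, rnorm (pi g v - pi x v) < e.
Proof.
move=> e0; have e0' : 0 < e%:C by rewrite ltcR.
have /cvgr_dist_lt/(_ _ e0') := @pi_cont v g.
by apply: filterS => x; rewrite rnormE ltcR.
Qed.

(** The scalar by which [g] acts can only be its coefficient at [psi]. Removing the existential
    turns membership into equations whose failure is an open condition. *)
Lemma pkerP (psi : H) g : rnorm psi = 1 ->
  pker_set pi g <-> forall v, pi g v = dotp (pi g psi) psi *: v.
Proof.
move=> psi1; have psi11 : dotp psi psi = 1 by rewrite dotpp psi1 expr1n.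
split=> [[z z1 gz] v|gE].
  by rewrite !gz dotpZl psi11 mulr1.
exists (dotp (pi g psi) psi) => //.
have : rnorm (pi g psi) = rnorm psi by rewrite rnorm_rep.
by rewrite {1}gE rnormZ psi1 mulr1 rnormE => ->.
Qed.

Lemma pker_closed (psi : H) : rnorm psi = 1 -> closed (pker_set pi).
Proof.
move=> psi1; rewrite -[pker_set pi]setCK; apply: open_closedC.
rewrite openE => g /= /(pkerP g psi1)/existsNP[v gv].
pose d := rnorm (pi g v - dotp (pi g psi) psi *: v).
have d0 : 0 < d.
  by rewrite lt_neqAle rnorm_ge0 eq_sym rnorm_eq0 subr_eq0 andbT; apply/eqP.
(* With this radius the error at [v] and the error at [psi], the latter multiplied by [rnorm v], add
   up to [d]. *)
have e0 : 0 < d / (1 + rnorm v).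
  by rewrite divr_gt0// ltr_pwDl// rnorm_ge0.
rewrite /interior.
apply: filterS (filterI (near_rep g v e0) (near_rep g psi e0)).
move=> x [/= xv xpsi] /(pkerP x psi1) xE.
suff : d < d by rewrite ltxx.
have dE : d = d / (1 + rnorm v) + d / (1 + rnorm v) * rnorm v.
  by field; rewrite gt_eqF// ltr_pwDl// rnorm_ge0.
rewrite [ltRHS]dE {1}/d -(subrKA (pi x v)) (le_lt_trans (rnormD _ _))// ltr_leD//.
rewrite xE -scalerBl -dotpBl rnormZ ler_wpM2r ?rnorm_ge0//.
rewrite (le_trans (cauchy_schwarz _ _))// psi1 mulr1 rnorm_distC.
exact: ltW.
Qed.

(** The modulus of the coefficient at [psi] does not change modulo the projective kernel and exceeds
    1/2 near the identity. Hence each translate of a small neighborhood contains at most one point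
    of the image, which yields all three topological conclusions. *)
Lemma separated_quotient (psi : H) (Gamma : set G) :
  locally_compact_group G -> rnorm psi = 1 ->
  (forall g h, Gamma g -> Gamma h -> g <> h ->
    rnorm (dotp (pi g psi) (pi h psi)) <= 2^-1) ->
  {in Gamma &, injective (@quotient_map G (pker pi))} /\
  let qGamma := @quotient_map G (pker pi) @` Gamma in
  [/\ left_relatively_separated qGamma, closed qGamma & discrete_subset qGamma].
Proof.
move=> [_ lcG] psi1 Gsep; set q := @quotient_map G (pker pi).
have pker_sep g h : Gamma g -> Gamma h -> q g = q h -> g = h.
  move=> Gg Gh /quotient_mapP[z z1 zE]; apply: contrapT => /(Gsep _ _ Gg Gh).
  rewrite dotp_rep_rep zE dotpZr rnormM rnorm_conj rnorm_dotpp psi1 expr1n mulr1.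
  have -> : rnorm z = 1 by apply: (@complexI R); rewrite -rnormE z1.
  by rewrite leNgt invf_lt1// ltr1n.
split=> [g h /set_mem Gg /set_mem Gh|]; first exact: pker_sep.
have hQ : hausdorff_space (quotient_group (pker pi)).
  by apply: quotient_hausdorff; exact: pker_closed psi1.
have [|A [B [nA nB AB]]] := @nbhs_divg G 1%g 1%g
    [set x | 2^-1 < rnorm (dotp psi (pi x psi))].
  have e0 : 0 < 2^-1 :> R by rewrite invr_gt0.
  have := near_rep (1^-1 * 1)%g psi e0; apply: filterS => x /=.
  rewrite mulVg rep1 => xpsi.
  have : rnorm (dotp psi psi) <= rnorm (dotp psi (psi - pi x psi)) +
      rnorm (dotp psi (pi x psi)).
    by rewrite dotpBr (le_trans _ (rnormD _ _))// subrK.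
  rewrite rnorm_dotpp psi1 expr1n => le1.
  have := cauchy_schwarz psi (psi - pi x psi); rewrite psi1 mul1r => le2.
  by move: xpsi le1 le2; lra.
have [C nC [cptC _]] := lcG 1%g I.
have {}nC : nbhs (1%g : G) C by move: nC; rewrite /within /=; apply: filterS => x; exact.
(* [A] and [B] keep the coefficient of [u^-1 * v] above 1/2; the compact [C] makes the image of [V]
   precompact. *)
pose V := A `&` B `&` C; have nV : nbhs (1%g : G) V.
  by apply: filterI => //; exact: filterI.
have cosetV (x : quotient_group (pker pi)) (a b : quotient_group (pker pi)) :
    (q @` Gamma) a -> (q @` Gamma) b ->
    (exists2 v, (q @` V) v & (x * v)%g = a) ->
    (exists2 v, (q @` V) v & (x * v)%g = b) -> a = b.
  move=> [g Gg <-] [h Gh <-].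
  move=> [_ [u [[Au _] _] <-]] xu [_ [v [[_ Bv] _] <-]] xv.
  congr q; apply: contrapT => /(Gsep _ _ Gg Gh).
  suff : 2^-1 < rnorm (dotp (pi g psi) (pi h psi)) by rewrite ltNge => /negP.
  (* Up to elements acting by unimodular scalars, [g] and [h] are [y * u] and [y * v], so [y]
     cancels in the coefficient. *)
  have [y xy] := quotient_map_surj x.
  move: xu xv; rewrite {}xy -!quotient_map_morph.
  move=> /quotient_mapP[z z1 zE] /quotient_mapP[w w1 wE].
  have -> : pi g psi = z *: pi (y * u)%g psi.
    by rewrite -repZ -zE -repMv mulVKg.
  have -> : pi h psi = w *: pi (y * v)%g psi.
    by rewrite -repZ -wE -repMv mulVKg.
  rewrite dotpZl dotpZr !rnormM rnorm_conj.
  have -> : rnorm z = 1 by apply: (@complexI R); rewrite -rnormE z1.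
  have -> : rnorm w = 1 by apply: (@complexI R); rewrite -rnormE w1.
  rewrite !mul1r dotp_rep_rep invgM -mulgA mulKg.
  exact: AB.
have nqV x : nbhs x [set (x * v)%g | v in q @` V].
  have [y ->] := quotient_map_surj x.
  have : nbhs y ((fun z => (y^-1 * z)%g) @^-1` V).
    by apply: mulgl_continuous; rewrite mulVg.
  move=> /(nbhs_quotient_map (pker pi)); apply: filterS => _ [z Vz <-].
  by exists (q (y^-1 * z)%g); [exists (y^-1 * z)%g|rewrite -quotient_map_morph mulVKg].
split.
- exists (q @` V); split.
  + by have := nbhs_quotient_map (pker pi) nV.
  + apply: (@precompact_subset _ _ (q @` C)).
      by move=> _ [v [_ Cv] <-]; exists v.
    have cq : compact (q @` C).
      apply: continuous_compact => //; apply: continuous_subspaceT.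
      exact: quotient_map_continuous.
    by rewrite precompact_closed//; exact: compact_closed.
  + exists 1%N => x; set L := (X in (X #<= _)%card).
    have [[a [La xa]]|L0] := pselect (exists a, L a); last first.
      suff -> : L = set0 by exact: card_ge0.
      by rewrite -subset0 => a La; apply: L0; exists a.
    apply: (@card_le_trans _ _ _ [set a]); last first.
      by have /card_eqPle[] := @card_set1 _ a.
    by apply: subset_card_le => b [Lb xb]; exact: (cosetV x b a).
- move=> a cla.
  have [b [Lb ab]] := cla _ (nqV a).
  suff -> : a = b by [].
  (* Every neighborhood of [a] meets the image inside the translate at [a], where [b] is its only
     point; so [a] and [b] cannot be separated. *)
  apply: hQ => A' B' nA' nB'.
  have [b' [Lb' [A'b' ab']]] := cla _ (filterI nA' (nqV a)).
  exists b; split; last exact: nbhs_singleton.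
  by rewrite -(cosetV a b' b).
- move=> a La; split; first exact: mem_set.
  exists [set (a * v)%g | v in q @` V]; first exact: nqV.
  apply/seteqP; split=> [b [ab Lb]|b ->].
    by apply: (cosetV a b a) => //; exact: (nbhs_singleton (nqV a)).
  by split => //; exact: nbhs_singleton.
Qed.

End ProjectiveKernelTopology.

(** * Rapidly decreasing coefficients *)

(* The recursion makes the tail of [c] after [n] of order [c n ^+ 3], negligible
   against [c n ^+ 2], the inverse of the block length [M n ^ 2]. *)
Lemma cubing_sequence (R : realType) (s : R) : 0 < s -> exists M : nat -> nat,
  let c n : R := (M n)%:R^-1 in
  [/\ forall n, (0 < M n)%N, c 0%N <= s, forall n, c n <= 2^-1 &
      forall n, c n.+1 = c n ^+ 3].
Proof.
(* Exceeding [s^-1] gives [c 0%N <= s]; the added 2 gives the bound by 1/2. *)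
move=> s0; pose B := (Num.bound s^-1).+2.
have B0 : 0 < B%:R :> R by rewrite ltr0n.
exists (fun n => (B ^ (3 ^ n))%N) => c; split => [n| |n|n].
- by rewrite expn_gt0.
- rewrite /c expn0 expn1 invf_ple ?posrE//.
  have := archi_boundP (ltW (_ : 0 < s^-1)); rewrite invr_gt0 => /(_ s0) /ltW.
  by move=> /le_trans; apply; rewrite ler_nat /B -addn2 leq_addr.
- rewrite /c lef_pV2 ?posrE ?ltr0n ?expn_gt0// ler_nat.
  by rewrite (@leq_trans (B ^ 1))// leq_exp2l// expn_gt0.
- by rewrite /c expnSr expnM natrX exprVn.
Qed.

Section CubingSequence.
Context (R : realType) (c : nat -> R).
Context (c_gt0 : forall n, 0 < c n) (c_half : forall n, c n <= 2^-1)
  (cS : forall n, c n.+1 = c n ^+ 3).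

Lemma cubing_half n : c n.+1 <= c n / 2.
Proof.
rewrite cS exprSr mulrC ler_wpM2l// ?(ltW (c_gt0 n))// (le_trans _ (c_half n))//.
rewrite expr2 -[leRHS]mulr1 ler_wpM2l// ?(ltW (c_gt0 n))//.
by rewrite (le_trans (c_half n))// invf_le1// ler1n.
Qed.

(** As [c] at least halves at each step, [c k] is at most [2 * c k - 2 * c k.+1], which
    telescopes. *)
Lemma cubing_sum n m : (n <= m)%N -> \sum_(n <= k < m) c k <= 2 * c n.
Proof.
move=> nm; apply: (@le_trans _ _ (2 * c n - 2 * c m)); last first.
  by rewrite gerBl mulr_ge0// ltW.
have -> : 2 * c n - 2 * c m = \sum_(n <= k < m) (2 * c k - 2 * c k.+1).
  rewrite (eq_bigr (fun k => (- (2 * c k.+1)) - (- (2 * c k)))) => [|k _].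
    by rewrite telescope_sumr// opprK addrC.
  by rewrite opprK addrC.
by apply: ler_sum => k _; have := cubing_half k; lra.
Qed.

Lemma cubing_small (e : R) : 0 < e -> exists n, c n < e.
Proof.
move=> e0; have [n ne] : exists n, (2^-1) ^+ n.+1 < e.
  have := @cvg_geometric R 1 2^-1; rewrite ger0_norm// invf_lt1// ltr1n => /(_ isT).
  move=> /cvgr0_norm_lt/(_ _ e0)[n _ /(_ n.+1 (leqnSn n))] /=.
  by rewrite mul1r ger0_norm ?exprn_ge0//; exists n.
exists n; apply: le_lt_trans ne; elim: n => //= n IH.
rewrite exprSr (le_trans (cubing_half n))// ler_wpM2r// invr_ge0.
Qed.

Lemma cubing_sum_sqr n : \sum_(k < n) c k ^+ 2 <= 4 * c 0%N ^+ 2.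
Proof.
have c2 k : c k <= 2 * c 0%N.
  apply: le_trans (cubing_sum (leq0n k.+1)).
  by rewrite big_nat_recr//= lerDr sumr_ge0// => i _; exact: ltW.
apply: (@le_trans _ _ (\sum_(0 <= k < n) c k * (2 * c 0%N))).
  rewrite big_mkord; apply: ler_sum => k _.
  by rewrite expr2 ler_wpM2l// ltW.
rewrite -mulr_suml; have := cubing_sum (leq0n n); have := c_gt0 0%N.
by set x := \sum_(_ <= _ < _) _; nra.
Qed.

End CubingSequence.

(** * Frame bounds for the block system *)

Section BlockFrame.
Context (G : groupType) (R : realType) (H : hilbertType R).
Variable pi : unitary_rep G H.
Variables (M : nat -> nat) (e x : nat -> H) (g : nat -> nat -> G).
Local Notation c n := ((M n)%:R^-1 : R).
Local Notation N n := (M n ^ 2)%N.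

(** The sum stops before [x n]: it involves only the stages preceding [n], which allows [g n i] to
    be chosen in terms of it. *)
Definition block_partial (n : nat) : H := \sum_(k < n) x k.
Local Notation Phi := block_partial.

Context (M_gt0 : forall n, (0 < M n)%N) (c_half : forall n, c n <= 2^-1)
  (cS : forall n, c n.+1 = c n ^+ 3).
Context (x_le : forall n, rnorm (x n) <= c n).
Context (gx_near : forall n i,
  rnorm (pi (g n i) (x n) - (c n)%:C *: e n) <= c n ^+ 2).
Context (Phi_gram : forall n l i j, (i < N n)%N -> (j < N l)%N ->
  (n, i) <> (l, j) ->
  rnorm (dotp (pi (g n i) (Phi n)) (pi (g l j) (Phi l))) <= c n ^+ 2 * c l ^+ 2).

Let c_gt0 n : 0 < c n. Proof. by rewrite invr_gt0 ltr0n. Qed.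

Let Nc n : (N n)%:R * c n ^+ 2 = 1.
Proof. by rewrite natrX -exprMn mulfV ?expr1n// pnatr_eq0 -lt0n. Qed.

Lemma block_partialB n m : (n <= m)%N -> rnorm (Phi m - Phi n) <= 2 * c n.
Proof.
move=> nm; rewrite /Phi -!(big_mkord xpredT x) (big_cat_nat (leq0n n) nm)//=.
rewrite addrAC subrr add0r (le_trans (rnorm_sum _ _ _))//.
apply: le_trans (cubing_sum c_gt0 c_half cS nm).
by apply: ler_sum => k _; exact: x_le.
Qed.

Lemma block_limit : exists phi, forall n, rnorm (phi - Phi n) <= 2 * c n.
Proof.
apply: hilbert_cauchy => [n m|s s0]; first exact: block_partialB.
have [|n cn] := @cubing_small R (fun n => c n) c_gt0 c_half cS (s / 2).
  by rewrite divr_gt0.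
by exists n; rewrite mulrC -ltr_pdivlMr.
Qed.

Lemma block_sig n (F : nat -> nat -> R) :
  \sum_(k < n) \sum_(i < N k) F k i =
  \sum_(p : {k : 'I_n & 'I_(N k)}) F (tag p) (tagged p).
Proof.
exact: (@sig_big_dep _ _ _ _ (fun k : 'I_n => 'I_(N k)) xpredT
  (fun _ => xpredT) (fun k i => F k i)).
Qed.

Lemma block_sum n (F : nat -> R) :
  \sum_(p : {k : 'I_n & 'I_(N k)}) c (tag p) ^+ 2 * F (tag p) = \sum_(k < n) F k.
Proof.
rewrite -(block_sig n (fun k _ => c k ^+ 2 * F k)); apply: eq_bigr => k _.
by rewrite big_const card_ord iter_addr_0 -[LHS]mulr_natl mulrA Nc mul1r.
Qed.

(** Cauchy-Schwarz term by term suffices: block [k] has [c k ^- 2] vectors, each contributing at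
    most [c k ^+ 4 * rnorm f ^+ 2]. *)
Lemma block_bessel n (u : {k : 'I_n & 'I_(N k)} -> H) (f : H) :
  (forall p, rnorm (u p) <= c (tag p) ^+ 2) ->
  \sum_p rnorm (dotp f (u p)) ^+ 2 <= 4 * c 0%N ^+ 2 * rnorm f ^+ 2.
Proof.
move=> uc; apply: (@le_trans _ _ (\sum_(k < n) c k ^+ 2 * rnorm f ^+ 2)).
  rewrite -(block_sum n (fun k => c k ^+ 2 * rnorm f ^+ 2)); apply: ler_sum => p _.
  apply: (@le_trans _ _ ((rnorm f * rnorm (u p)) ^+ 2)).
    by rewrite ler_pXn2r// ?nnegrE ?mulr_ge0 ?rnorm_ge0// cauchy_schwarz.
  rewrite exprMn mulrC mulrA ler_wpM2r ?sqr_ge0// -expr2.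
  by rewrite ler_pXn2r// ?nnegrE ?rnorm_ge0// sqr_ge0.
rewrite -mulr_suml ler_wpM2r ?sqr_ge0//.
exact: (@cubing_sum_sqr R (fun n => c n) c_gt0 c_half cS).
Qed.

Lemma block_frame (eps : R) (phi f : H) (n : nat) :
  0 < eps -> eps < 1 -> c 0%N <= eps / 7 ->
  (forall n, rnorm (phi - Phi n) <= 2 * c n) ->
  \sum_(k < n) rnorm (dotp f (e k)) ^+ 2 <= rnorm f ^+ 2 ->
  (1 - eps) * \sum_(k < n) rnorm (dotp f (e k)) ^+ 2 -
    eps * (1 - eps) * rnorm f ^+ 2 <=
  \sum_(k < n) \sum_(i < N k) rnorm (dotp f (pi (g k i) phi)) ^+ 2 <=
  (1 + eps) ^+ 2 * rnorm f ^+ 2.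
Proof.
move=> eps0 eps1 ceps phiP ef.
pose I := {k : 'I_n & 'I_(N k)}; pose gI (p : I) := g (tag p) (tagged p).
(* The noise: [y1] is the error in reproducing [e], [y2] the image of the earlier terms of [phi],
   [y3] that of the later ones. *)
pose y1 (p : I) := pi (gI p) (x (tag p)) - (c (tag p))%:C *: e (tag p).
pose y2 (p : I) := pi (gI p) (Phi (tag p)).
pose y3 (p : I) := pi (gI p) (phi - Phi (tag p).+1).
have -> : \sum_(k < n) \sum_(i < N k) rnorm (dotp f (pi (g k i) phi)) ^+ 2 =
    \sum_(p : I) rnorm (dotp f ((c (tag p))%:C *: e (tag p)) +
      dotp f (y1 p + y2 p + y3 p)) ^+ 2.
  rewrite (block_sig n (fun k i => rnorm (dotp f (pi (g k i) phi)) ^+ 2)).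
  apply: eq_bigr => p _; rewrite -dotpDr /y1 /y2 /y3 /Phi big_ord_recr/=.
  rewrite -!addrA addrCA addNKr -!repD; congr (rnorm (dotp f (pi _ _)) ^+ 2).
  by rewrite addrA [x _ + _]addrC addrC subrK.
apply: bessel_perturb => //.
  rewrite -[RHS](block_sum n (fun k => rnorm (dotp f (e k)) ^+ 2)); apply: eq_bigr => p _.
  by rewrite dotpZr rnormM rnorm_conj rnorm_real exprMn real_normK ?num_real.
apply: (@le_trans _ _ (\sum_(p : I) 3 * (rnorm (dotp f (y1 p)) ^+ 2 +
    rnorm (dotp f (y2 p)) ^+ 2 + rnorm (dotp f (y3 p)) ^+ 2))).
  apply: ler_sum => p _; apply: le_trans (sqr_sum3_le _ _ _).
  rewrite ler_pXn2r// ?nnegrE ?addr_ge0 ?rnorm_ge0// !dotpDr.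
  by rewrite (le_trans (rnormD _ _))// lerD2r rnormD.
rewrite -mulr_sumr !big_split/=.
have b1 : \sum_p rnorm (dotp f (y1 p)) ^+ 2 <= 4 * c 0%N ^+ 2 * rnorm f ^+ 2.
  by apply: block_bessel => p; exact: gx_near.
have b3 : \sum_p rnorm (dotp f (y3 p)) ^+ 2 <= 4 * c 0%N ^+ 2 * rnorm f ^+ 2.
  (* The tail after stage [k] has norm at most [2 * c k.+1 = 2 * c k ^+ 3], hence at most [c k ^+ 2]
     because [c k <= 2^-1]. *)
  apply: block_bessel => p; rewrite rnorm_rep (le_trans (phiP _))// cS.
  by have := c_half (tag p); have := c_gt0 (tag p); nra.
(* The diagonal constant comes from [rnorm (Phi k) <= 2 * c 0], the off-diagonal one from summing
   [c k ^+ 4] over the blocks. *)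
have b2 : \sum_p rnorm (dotp f (y2 p)) ^+ 2 <=
    (4 * c 0%N ^+ 2 + 4 * c 0%N ^+ 2) * rnorm f ^+ 2.
  apply: (@gram_bessel _ _ I y2 (fun p => c (tag p) ^+ 2)) => [|p|[k i] [l j] kl|].
  - by rewrite mulr_ge0// sqr_ge0.
  - rewrite rnorm_rep; have := block_partialB (leq0n (tag p)).
    rewrite {2}/Phi big_ord0 subr0 => le2.
    rewrite -[4](_ : 2 ^+ 2 = _ :> R); last by rewrite -natrX.
    by rewrite -exprMn ler_pXn2r// nnegrE ?rnorm_ge0// mulr_ge0// ltW.
  - apply: Phi_gram => //=.
    move=> [/val_inj kE]; move: i j kl; rewrite kE => i j kl /val_inj ij.
    by move: kl; rewrite ij eqxx.
  - rewrite (eq_bigr (fun p : I => c (tag p) ^+ 2 * c (tag p) ^+ 2)); last first.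
      by move=> p _; rewrite -expr2.
    rewrite (block_sum n (fun k => c k ^+ 2)).
    exact: (@cubing_sum_sqr R (fun n => c n) c_gt0 c_half cS).
have c0 := c_gt0 0%N.
(* The three parts give [3 * (4 + 8 + 4) = 48], and 48 is below 49, the square of the 7 in
   [eps / 7]. *)
apply: (@le_trans _ _ (48 * c 0%N ^+ 2 * rnorm f ^+ 2)); first by lra.
by rewrite ler_wpM2r ?sqr_ge0//; nra.
Qed.

End BlockFrame.

(** * Choice of the points and of the mixing times *)

Section Selection.
Context (G : topologicalGroupType) (R : realType) (H : hilbertType R).
Variable pi : unitary_rep G H.
Context (pi_cont : strongly_continuous pi).
Variable datum : local_mixing_expansion_datum pi.
Local Notation A := (datum_group datum).
Local Notation p := (datum_hom (l := datum)).
Local Notation h := (datum_seq datum).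
Local Notation U := (datum_nbhd (l := datum)).

Lemma datum_hom1 : p 1%g = 1%g.
Proof.
by apply: (mulgI (p 1%g)); rewrite -(datum_homM (l := datum)) !mulg1.
Qed.

Lemma datum_homVM a b : p (a^-1 * b)%g = ((p a)^-1 * p b)%g.
Proof. by apply: (mulgI (p a)); rewrite -(datum_homM (l := datum)) !mulVKg. Qed.

(** Infinitely many points lie in a neighborhood of the identity so small that all quotients
    [a^-1 * b] fall in [U] and the action on [v] is almost trivial. *)
Lemma datum_points (v : H) (r : R) : 0 < r -> exists a : nat -> A,
  (forall i, rnorm (pi (p (a i)) v - v) <= r) /\
  (forall i j, i <> j -> U ((a i)^-1 * a j)%g /\ ((a i)^-1 * a j)%g <> 1%g).
Proof.
move=> r0.
have [|B [C [nB nC BC]]] := @nbhs_divg A 1%g 1%g U.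
  by rewrite mulVg; exact: datum_nbhdP.
have nD : nbhs (1%g : A) [set a | rnorm (pi (p a) v - v) <= r].
  have pD : nbhs (p 1%g) [set x | rnorm (pi x v - v) <= r].
    have := near_rep pi_cont 1%g v r0; rewrite datum_hom1; apply: filterS => x /=.
    by rewrite rep1 rnorm_distC => /ltW.
  exact: (datum_hom_continuous (l := datum)) pD.
have : infinite_set (B `&` C `&` [set a | rnorm (pi (p a) v - v) <= r]).
  apply: nbhs_infinite (filterI (filterI nB nC) nD).
    exact: datum_hausdorff.
  exact: datum_nondiscrete.
move=> /infiniteP/card_leP[f]; pose a i := val (f (to_setT i)).
have aP i := set_valP (f (to_setT i)).
exists a; split=> [i|i j ij]; first by have [] := aP i.
have [[Bi _] _] := aP i; have [[_ Cj] _] := aP j; split; first exact: BC.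
move=> /(congr1 (fun b => a i * b)%g); rewrite mulVKg mulg1.
move=> /val_inj/(inj (f := f)) aji; apply: ij; apply/esym.
by have /(congr1 val) := aji (in_setT _) (in_setT _).
Qed.

(** The relative element [(p a * h^-1)^-1 * (p b * h^-1)] is the conjugate
    [h * p (a^-1 * b) * h^-1], to which the expansion property applies. *)
Lemma near_expansion (a b : A) (u v : H) (r : R) : 0 < r ->
  U (a^-1 * b)%g -> (a^-1 * b)%g <> 1%g ->
  \forall x \near \oo,
    rnorm (dotp (pi (p a * (h x)^-1)%g u) (pi (p b * (h x)^-1)%g v)) <= r.
Proof.
move=> r0 Uab ab1.
have := wot_cvg0_near u v (datum_expansion Uab ab1) r0; apply: filterS => x.
by rewrite dotp_rep_rep invgM invgK datum_homVM !mulgA.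
Qed.

Lemma near_mixing (a : G) (u v : H) (r : R) : 0 < r ->
  \forall x \near \oo, rnorm (dotp (pi (a * (h x)^-1)%g u) v) <= r.
Proof.
move=> r0.
have := wot_cvg0_near u (pi a^-1%g v) (datum_mixing datum) r0.
apply: filterS => x.
by rewrite -[in X in _ -> X](rep1 pi v) dotp_rep_rep mulg1 invgM invgK repMv.
Qed.

(** Since [w m n] depends only on the values of [m] below [n], stage [n] imposes finitely many
    conditions on [m n], each true for all large indices: expansion handles pairs in the same block
    ([P1]), mixing pairs with earlier blocks ([P2]). *)
Lemma mixing_selection (N : nat -> nat) (a : nat -> nat -> A)
    (w : (nat -> nat) -> nat -> H) (t : nat -> R) :
  (forall n, 0 < t n) ->
  (forall n i j, i <> j ->
    U ((a n i)^-1 * a n j)%g /\ ((a n i)^-1 * a n j)%g <> 1%g) ->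
  (forall m m' n, (forall k, (k < n)%N -> m k = m' k) -> w m n = w m' n) ->
  forall psi : H, exists m : nat -> nat,
  let g n i := (p (a n i) * (h (m n))^-1)%g in
  forall n l i j, (i < N n)%N -> (j < N l)%N -> (n, i) <> (l, j) ->
    rnorm (dotp (pi (g n i) (w m n)) (pi (g l j) (w m l))) <= t n * t l /\
    rnorm (dotp (pi (g n i) psi) (pi (g l j) psi)) <= 2^-1.
Proof.
move=> t0 aU w_ext psi.
have half0 : 0 < 2^-1 :> R by rewrite invr_gt0.
pose close x n i (u : H) y (v : H) (r : R) :=
  rnorm (dotp (pi (p (a n i) * (h x)^-1)%g u) (pi y v)) <= r.
pose P1 (m : nat -> nat) n x := forall i j : 'I_(N n), i != j ->
  close x n i (w m n) (p (a n j) * (h x)^-1)%g (w m n) (t n * t n) /\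
  close x n i psi (p (a n j) * (h x)^-1)%g psi 2^-1.
pose P2 (m : nat -> nat) n x := forall (i : 'I_(N n)) (l : 'I_n) (j : 'I_(N l)),
  close x n i (w m n) (p (a l j) * (h (m l))^-1)%g (w m l) (t n * t l) /\
  close x n i psi (p (a l j) * (h (m l))^-1)%g psi 2^-1.
pose P m n x := P1 m n x /\ P2 m n x.
have [m mP] : exists m, forall n, P m n (m n).
  apply: course_of_values_choice => [m m' n x mm' [Q1 Q2]|m n].
    split=> [i j ij|i l j]; first by rewrite -(w_ext _ _ _ mm'); exact: Q1.
    rewrite -(w_ext _ _ _ mm') -(mm' l)//.
    rewrite -(w_ext m m' l); first exact: Q2.
    by move=> k kl; apply: mm'; exact: ltn_trans kl _.
  have nP1 : \forall x \near \oo, P1 m n x.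
    apply: filter_forall => i; apply: filter_forall => j.
    have [->|ij] := eqVneq i j; first by apply: nearW => x /negP.
    have [|Uij ij1] := aU n i j; first by move/val_inj/eqP; exact/negP.
    have := near_expansion psi psi half0 Uij ij1.
    have := near_expansion (w m n) (w m n) (mulr_gt0 (t0 n) (t0 n)) Uij ij1.
    by apply: filterS2 => x.
  have nP2 : \forall x \near \oo, P2 m n x.
    apply: filter_forall => i; apply: filter_forall => l.
    apply: filter_forall => j; rewrite /close.
    have := near_mixing (p (a n i)) psi
      (pi (p (a l j) * (h (m l))^-1)%g psi) half0.
    have := near_mixing (p (a n i)) (w m n)
      (pi (p (a l j) * (h (m l))^-1)%g (w m l)) (mulr_gt0 (t0 n) (t0 l)).
    by apply: filterS2 => x.
  have [x [Q1 Q2]] := filter_ex (filterI nP1 nP2).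
  by exists x.
exists m => g n l i j iN jN.
have [ln|nl|nl] := ltngtP l n; last first.
- move: jN; rewrite nl => jN nij.
  have ij : Ordinal iN != Ordinal jN.
    by apply/eqP => -[ij]; apply: nij; rewrite ij.
  exact: (mP n).1 ij.
(* The later stage carries the estimate; Hermitian symmetry exchanges the two. *)
- move=> _; have [wt psit] := (mP l).2 (Ordinal jN) (Ordinal nl) (Ordinal iN).
  by split; rewrite rnorm_dotpC//; rewrite [leRHS]mulrC.
- by move=> _; exact: (mP n).2 (Ordinal iN) (Ordinal ln) (Ordinal jN).
Qed.

End Selection.

(** * Summation over the blocks and assembly of the frame *)

Lemma esum_blocks (R : realType) (T : choiceType) (N : nat -> nat)
    (g : nat -> nat -> T) (F : T -> R) :
  (forall x, 0 <= F x) ->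
  (forall n l i j, (i < N n)%N -> (j < N l)%N -> g n i = g l j ->
    (n, i) = (l, j)) ->
  (\esum_(x in [set x | exists n i, (i < N n)%N /\ g n i = x]) (F x)%:E =
   \sum_(n <oo) (\sum_(i < N n) F (g n i))%:E)%E.
Proof.
move=> F0 ginj.
rewrite (reindex_esum (setT `*`` (fun n => `I_(N n))) _ (fun k => g k.1 k.2)).
  rewrite -(@esum_esum _ _ _ setT (fun n => `I_(N n)) (fun n i => (F (g n i))%:E)).
    rewrite nneseries_esumT => [|n]; last first.
      by rewrite lee_fin sumr_ge0.
    apply: eq_esum => n _; rewrite esum_fset//=; last first.
      by move=> i _; rewrite lee_fin.
    by rewrite -fsbig_ord sumEFin.
  by move=> *; rewrite lee_fin.
split=> [[n i] [_ /= iN]|[n i] [l j] /set_mem[_ /= iN] /set_mem[_ /= jN]|].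
- by exists n, i.
- exact: ginj.
- by move=> _ [n [i [iN <-]]]; exists (n, i).
Qed.

Theorem theorem3p6 (R : realType) (G : topologicalGroupType)
    (H : hilbertType R) (pi : unitary_rep G H)
    (G_lc : locally_compact_group G) (G_sc : @second_countable G)
    (H_inf : ~ finite_dimensional H) (H_sep : separable_space H)
    (pi_cont : strongly_continuous pi)
    (datum : local_mixing_expansion_datum pi)
    (eps : R) (eps_gt0 : 0 < eps) (eps_lt1 : eps < 1) :
  exists (phi : H) (Gamma : set G),
    [/\ phi <> 0,
        countable Gamma,
        forall f : H,
          ((((1 - eps) ^+ 2 * rnorm f ^+ 2)%:E <=
             \esum_(g in Gamma)
                (rnorm (dotp f (pi g phi)) ^+ 2)%:E)%E /\
           (\esum_(g in Gamma)
                (rnorm (dotp f (pi g phi)) ^+ 2)%:E <=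
             ((1 + eps) ^+ 2 * rnorm f ^+ 2)%:E)%E),
        {in Gamma &, injective (@quotient_map G (pker pi))} &
        let qGamma := @quotient_map G (pker pi) @` Gamma in
        [/\ left_relatively_separated qGamma,
            closed qGamma & discrete_subset qGamma]].
Proof.
(* Without a unit vector the space would be zero, hence of finite dimension. *)
have [psi psi1] : exists psi : H, rnorm psi = 1.
  apply: contrapT => noH; apply: H_inf; exists 0%N, (fun=> 0) => v.
  exists (fun=> 0); rewrite big_ord0; apply: contrapT => /eqP v0.
  by apply: noH; exists (normalize v); rewrite rnorm_normalize.
have [e [e_le1 e_bessel e_parseval]] := parseval_sequence H_sep.
have [M] : exists M : nat -> nat, let c n : R := (M n)%:R^-1 in
    [/\ forall n, (0 < M n)%N, c 0%N <= eps / 7, forall n, c n <= 2^-1 &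
    forall n, c n.+1 = c n ^+ 3] by apply: cubing_sequence; rewrite divr_gt0.
pose c n : R := (M n)%:R^-1; pose N n := (M n ^ 2)%N => -[M_gt0 c0 c_half cS].
have c_gt0 n : 0 < c n by rewrite invr_gt0 ltr0n.
(* Precision [c n] becomes the required [c n ^+ 2] after the scaling by [c n] in [x]. *)
have /choice[a aP] n := datum_points pi_cont datum (e n) (c_gt0 n).
pose x (m : nat -> nat) k := (c k)%:C *: pi (datum_seq datum (m k)) (e k).
have c2_gt0 n : 0 < c n ^+ 2 by rewrite exprn_gt0.
have w_ext (m m' : nat -> nat) n : (forall k, (k < n)%N -> m k = m' k) ->
    block_partial (x m) n = block_partial (x m') n.
  by move=> mm'; apply: eq_bigr => k _; rewrite /x mm'.
have [m mP] := mixing_selection N c2_gt0 (fun n => (aP n).2) w_ext psi.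
pose g n i := (datum_hom (a n i) * (datum_seq datum (m n))^-1)%g.
have x_le n : rnorm (x m n) <= c n.
  by rewrite rnormZ rnorm_real rnorm_rep ger0_norm ?ler_piMr// ltW.
have gx_near n i : rnorm (pi (g n i) (x m n) - (c n)%:C *: e n) <= c n ^+ 2.
  rewrite repZ -repMv mulgVK -scalerBr rnormZ rnorm_real ger0_norm ?(ltW (c_gt0 _))//.
  by rewrite expr2 ler_wpM2l ?(ltW (c_gt0 _))//; exact: (aP n).1.
have Phi_gram n l i j : (i < N n)%N -> (j < N l)%N -> (n, i) <> (l, j) ->
    rnorm (dotp (pi (g n i) (block_partial (x m) n))
                (pi (g l j) (block_partial (x m) l))) <= c n ^+ 2 * c l ^+ 2.
  by move=> iN jN nij; have [] := mP n l i j iN jN nij.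
have psi_sep n l i j : (i < N n)%N -> (j < N l)%N -> (n, i) <> (l, j) ->
    rnorm (dotp (pi (g n i) psi) (pi (g l j) psi)) <= 2^-1.
  by move=> iN jN nij; have [] := mP n l i j iN jN nij.
have [phi phiP] := block_limit M_gt0 c_half cS x_le.
have frame f n := block_frame M_gt0 c_half cS x_le gx_near Phi_gram
  eps_gt0 eps_lt1 c0 phiP (e_bessel n f).
have g_inj n l i j : (i < N n)%N -> (j < N l)%N -> g n i = g l j ->
    (n, i) = (l, j).
  (* Coinciding elements would have coefficient 1 at [psi], above 1/2. *)
  move=> iN jN gE; apply: contrapT => /(psi_sep _ _ _ _ iN jN).
  rewrite gE dotp_rep rnorm_dotpp psi1 expr1n.
  by rewrite leNgt invf_lt1// ltr1n.
pose Gamma : set G := [set y | exists n i, (i < N n)%N /\ g n i = y].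
have sumE f := esum_blocks (F := fun y => rnorm (dotp f (pi y phi)) ^+ 2)
  (fun=> sqr_ge0 _) g_inj.
have lower f : ((((1 - eps) ^+ 2 * rnorm f ^+ 2)%:E <=
    \esum_(y in Gamma) (rnorm (dotp f (pi y phi)) ^+ 2)%:E)%E).
  rewrite sumE; apply/lee_addgt0Pr => d d0.
  (* Once the finite Parseval sum is within [d] of [rnorm f ^+ 2], the lower frame bound loses at
     most [(1 - eps) * d]. *)
  have [|n fn] := e_parseval f (rnorm f ^+ 2 - d); first by rewrite gtrBl.
  have /andP[fr _] := frame f n.
  apply: (@le_trans _ _ ((\sum_(k < n) \sum_(i < N k)
      rnorm (dotp f (pi (g k i) phi)) ^+ 2)%:E + d%:E)%E).
    rewrite -EFinD lee_fin -lerBlDr; apply: le_trans fr.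
    by move: fn; set X := \sum_(k < n) _ => fn; nra.
  rewrite leeD2r// -sumEFin -(big_mkord xpredT (fun k =>
    (\sum_(i < N k) rnorm (dotp f (pi (g k i) phi)) ^+ 2)%:E)).
  by apply: nneseries_lim_ge => k _ _; rewrite lee_fin sumr_ge0// => i _; exact: sqr_ge0.
have [|Gamma_inj Gamma_sep] := separated_quotient pi_cont (Gamma := Gamma) G_lc psi1.
  move=> _ _ [n [i [iN <-]]] [l [j [jN <-]]] gij; apply: psi_sep => //.
  by move=> nij; apply: gij; case: nij => -> ->.
exists phi, Gamma; split.
(* A zero [phi] would make the sum vanish, against the lower bound at [psi]. *)
- move=> phi0; have := lower psi; rewrite sumE phi0 psi1.
  rewrite eseries0 => [|n _ _]; last first.
    by rewrite big1// => i _; rewrite -(scale0r 0) repZ scale0r linear0r rnorm0 expr0n.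
  by rewrite expr1n mulr1 lee_fin leNgt exprn_gt0// subr_gt0.
- apply: (@sub_countable _ _ _ [set g k.1 k.2 | k in [set: nat * nat]]).
    by apply: subset_card_le => _ [n [i [_ <-]]]; exists (n, i).
  exact: card_le_trans (card_image_le _ _) (countableP _).
- move=> f; split=> //; rewrite sumE.
  apply: lime_le.
    by apply: is_cvg_nneseries => k _ _; rewrite lee_fin sumr_ge0// => i _; exact: sqr_ge0.
  apply: nearW => n; rewrite sumEFin lee_fin big_mkord.
  by have /andP[] := frame f n.
- exact: Gamma_inj.
- exact: Gamma_sep.
Qed.
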